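(* Let $(X,Y)$ be a conditionally dependent (CD) random vector with function $s$, where $X$ has distribution $F$ and $Y$ has distribution $G$. Assume $F\in\mathscr R_{-\alpha}$ for some $\alpha\ge0$, with $\overline F(x)\sim x^{-\alpha}L(x)$ for a positive slowly varying function $L$, and $\overline G(x)=o(\overline F(x))$ as $x\to\infty$. Suppose that either (i) $\mathrm E\big(Y^{\alpha+\varepsilon}s(Y)\big)<\infty$ for some $\varepsilon>0$; or (ii) there exists a positive function $g$ on $[0,\infty)$ with $g(x)\downarrow0$, $xg(x)\uparrow\infty$ and $\overline G(xg(x))=o(\overline F(x))$, such that $\limsup_{x\to\infty}\sup_{1\le y\le xg(x)}L(x/y)/L(x)<\infty$, and $\mathrm E\big(Y^\alpha s(Y)\big)<\infty$. Then, with $H$ the distribution of $XY$, $$\overline H(x)=\mathrm P(XY>x)\sim\mathrm E\big(Y^\alpha s(Y)\big)\overline F(x),\qquad x\to\infty.$$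
   Context: $X$ is real-valued with distribution $F$ such that $\overline F(x)=1-F(x)>0$ for all $x\in\mathbb{R}$, and $Y$ takes values in $(0,\infty)$ with distribution $G$, $\overline G=1-G$. $D_Y=\{y\in(0,\infty):\mathrm P(Y\in(y-\delta,y+\delta))>0\ \forall\delta>0\}$. For $x\in\mathbb{R}$, $y\in D_Y$, $\mathrm P(X>x\mid Y=y)=\lim_{t\downarrow0}\mathrm P(X>x,Y\in[y,y+t))/\mathrm P(Y\in[y,y+t))$ when the limit exists. $(X,Y)$ is conditionally dependent (CD) with function $s$ if $s$ is a positive measurable function on $[0,\infty)$ such that these conditional tails exist and $\lim_{x\to\infty}\sup_{y\in D_Y}|\mathrm P(X>x\mid Y=y)/(\overline F(x)s(y))-1|=0$. $F\in\mathscr R_{-\alpha}$ (regularly varying tail with index $\alpha$) means $\overline F(xy)/\overline F(x)\to y^{-\alpha}$ as $x\to\infty$ for each $y>0$; $L$ is slowly varying if $L(xy)/L(x)\to1$ for each $y>0$. $a(x)\sim b(x)$ means $a(x)/b(x)\to1$ as $x\to\infty$. *)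

(* Defs.v *)
From HB Require Import structures.
From mathcomp Require Import all_boot all_order all_algebra.
From mathcomp Require Import all_classical all_reals all_analysis.
Set Implicit Arguments. Unset Strict Implicit. Unset Printing Implicit Defensive.
Import Order.TTheory GRing.Theory Num.Theory.
Import numFieldNormedType.Exports.
Local Open Scope classical_set_scope.
Local Open Scope ring_scope.

Section Defs.
Context (R : realType) (d : measure_display) (T : measurableType d)
  (P : probability T R).

Definition tailP (Z : T -> R) (x : R) : R := fine (P [set w | x < Z w]).

Definition DY (Y : T -> R) : set R :=
  [set y : R | 0 < y /\ forall delta : R, 0 < delta ->
     (0%:E < P [set w | (y - delta < Y w < y + delta)%R])%E].

Definition cond_ratio (X Y : T -> R) (x y t : R) : R :=
  fine (P [set w | x < X w /\ y <= Y w < y + t]) /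
  fine (P [set w | y <= Y w < y + t]).

Definition cond_tail_exists (X Y : T -> R) (x y : R) : Prop :=
  cvg (cond_ratio X Y x y t @[t --> 0^'+]).

(* P(X > x | Y = y), the value of that limit *)
Definition cond_tail (X Y : T -> R) (x y : R) : R :=
  lim (cond_ratio X Y x y t @[t --> 0^'+]).

Definition CD (X Y : T -> R) (s : R -> R) : Prop :=
  (forall y, 0 <= y -> 0 < s y) /\
  measurable_fun (`[0, +oo[%classic : set R) s /\
  (forall x y, DY Y y -> cond_tail_exists X Y x y) /\
  (forall e : R, 0 < e -> exists x0 : R, forall x, x0 < x ->
     forall y, DY Y y ->
       `| cond_tail X Y x y / (tailP X x * s y) - 1 | <= e).
End Defs.

Definition regvar_tail (R : realType) (Fbar : R -> R) (alpha : R) : Prop :=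
  forall y : R, 0 < y ->
    Fbar (x * y) / Fbar x @[x --> +oo] --> y `^ (- alpha).

Definition slowly_varying (R : realType) (L : R -> R) : Prop :=
  forall y : R, 0 < y -> L (x * y) / L x @[x --> +oo] --> (1 : R).

(* Main.v *)
Require Import Defs.
From HB Require Import structures.
From mathcomp Require Import all_boot all_order all_algebra.
From mathcomp Require Import all_classical all_reals all_analysis.
From mathcomp Require Import measurable_realfun ring lra.
Import Order.TTheory GRing.Theory Num.Theory.
Import numFieldNormedType.Exports.
Local Open Scope classical_set_scope.
Local Open Scope ring_scope.

(** The conditional tail P(X > x | Y = y) is a one-sided derivative of the
    measure P(X > x, Y in .) with respect to the law of Y. Bounds on such a
    derivative at every point integrate to bounds on the measures: after inner
    and outer regularity this is a continuous induction along half-open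
    intervals, and no differentiation theorem is needed. Applied to
    P(XY > x, Y in .), whose derivative at y lies between
    (1 - e) F(x/y) s(y) and (1 + e) F(x/y) s(y) for large x/y (with F the tail
    of X), it gives P(XY > x, Y <= c) ~ E(F(x/Y) s(Y); Y <= c) uniformly for
    x/c large. A truncation level c = h(x) at which P(Y > h(x)) = o(F(x)) is
    available in both cases: h(x) = x/x1 with Potter's bound, or
    h(x) = x g(x). Dominated convergence finishes the proof. *)

(** * Regularity of finite Borel measures on the line *)

Lemma bigcap_itvoo_invn {R : realType} (x : R) :
  \bigcap_n `]x, x + n.+1%:R^-1[%classic = set0 :> set R.
Proof.
rewrite -subset0 => y /= H.
have /= := H 0%N Logic.I; rewrite in_itv/= => /andP[xy _].
have [n] := ltr_add_invr xy.
by have /= := H n Logic.I; rewrite in_itv/= => /andP[_ /ltW]; rewrite leNgt => /negP.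
Qed.

(** The sets squeezed between a closed and an open set up to any error form a sigma-algebra, and
    this class contains the open rays that generate the Borel sets. Finiteness of [mu] provides
    continuity from above. *)
Lemma finite_measure_regular {R : realType} (mu : {measure set R -> \bar R}) :
  (mu setT < +oo)%E -> forall A : set R, measurable A -> forall e : R, 0 < e ->
  exists C U : set R, [/\ closed C, open U, C `<=` A, A `<=` U &
    (mu (U `\` C) < e%:E)%E].
Proof.
move=> muT.
pose G : set (set R) := [set A | forall e : R, 0 < e ->
  exists C U : set R, [/\ closed C, open U, C `<=` A, A `<=` U &
    (mu (U `\` C) < e%:E)%E]].
have mufin A : measurable A -> (mu A < +oo)%E.
  move=> mA; apply: le_lt_trans muT; apply: le_measure; rewrite ?inE//.
suff : measurable `<=` G by move=> H A mA; exact: H.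
have mE : (measurable : set (set R)) = (@RGenOInfty.G R).-sigma.-measurable.
  exact: RGenOInfty.measurableE.
rewrite mE.
apply: smallest_sub; last first.
  move=> _ [x ->] e e0.
  pose D (n : nat) : set R := `]x, x + n.+1%:R^-1[%classic.
  have cD : (mu \o D) n @[n --> \oo] --> 0%E.
    rewrite -(measure0 mu) -(bigcap_itvoo_invn x).
    apply: nonincreasing_cvg_mu.
    - by apply: mufin; exact: measurable_itv.
    - by move=> n; exact: measurable_itv.
    - by apply: bigcapT_measurable => n; exact: measurable_itv.
    - move=> m n mn; apply/subsetPset => y; rewrite /D/= !in_itv/= => /andP[-> yn]/=.
      by apply: (lt_le_trans yn); rewrite lerD2l lef_pV2 ?posrE ?ltr0n// ler_nat.
  have e0' : (0 < e%:E)%E by rewrite lte_fin.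
  have [n _ /(_ n (leqnn n)) nD] := cD _ (open_ereal_lt' e0').
  (* The ray is already open, so only a closed inner set has to be found; the gap [D n] decreases to
     the empty set. *)
  exists `[x + n.+1%:R^-1, +oo[%classic, `]x, +oo[%classic; split => //.
  - exact: interval_closed.
  - by move=> y/=; rewrite !in_itv/= !andbT => xy; rewrite (lt_le_trans _ xy)// ltrDl invr_gt0.
  - suff -> : `]x, +oo[ `\` `[(x + n.+1%:R^-1), +oo[ = D n by [].
    apply/seteqP; split => y /=; rewrite !in_itv/= !andbT.
      by move=> [xy /negP]; rewrite -ltNge => yx; apply/andP.
    by move=> /andP[xy yx]; split => //; apply/negP; rewrite -ltNge.
split.
- by move=> e e0; exists set0, set0; rewrite setD0 measure0 lte_fin; split => //; exact: closed0.
- move=> A GA e /GA[C [U [cC oU CA AU muUC]]].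
  exists (~` U), (~` C); split => //.
  + by rewrite closedC.
  + by rewrite openC.
  + by rewrite setTD; exact: subsetC.
  + by rewrite setTD; exact: subsetC.
  + suff -> : ~` C `\` ~` U = U `\` C by [].
    by rewrite setDE setCK setIC -setDE.
- move=> A GA e e0.
  pose r (n : nat) : R := (e / 2) / (2 ^ n.+1)%:R.
  have r0 n : 0 < r n by rewrite !divr_gt0// ltr0n expn_gt0.
  have /choice[CU HCU] : forall n, exists CU : set R * set R,
      [/\ closed CU.1, open CU.2, CU.1 `<=` A n, A n `<=` CU.2 &
        (mu (CU.2 `\` CU.1) < (r n)%:E)%E].
    by move=> n; have [C [U HCU]] := GA n _ (r0 n); exists (C, U).
  pose C n := (CU n).1; pose U n := (CU n).2.
  have mC n : measurable (C n) by apply: closed_measurable; have [] := HCU n.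
  have mU n : measurable (U n) by apply: open_measurable; have [] := HCU n.
  (* An infinite union of closed sets may fail to be closed, so only finitely many [C i] are kept.
     The sets [D N] decrease to a set of measure at most [e / 2], hence some finite stage has
     measure below [e]. *)
  pose D N := \bigcup_n U n `\` \big[setU/set0]_(i < N) C i.
  have mbU : measurable (\bigcup_n U n) by exact: bigcupT_measurable.
  have mbC : measurable (\bigcup_n C n) by exact: bigcupT_measurable.
  have mD N : measurable (D N).
    by apply: measurableD => //; apply: bigsetU_measurable => i _.
  have DE : \bigcap_n D n = \bigcup_n U n `\` \bigcup_n C n.
    apply/seteqP; split => y.
      move=> H; split; first by have [] := H 0%N Logic.I.
      move=> [n _ Cny]; have [_] := H n.+1 Logic.I; apply.
      by rewrite -bigcup_mkord; exists n => /=.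
    move=> [Uy nCy] n _; split => //; rewrite -bigcup_mkord => -[i _ Ciy].
    by apply: nCy; exists i.
  have cD : (mu \o D) n @[n --> \oo] --> mu (\bigcup_n U n `\` \bigcup_n C n).
    rewrite -DE; apply: nonincreasing_cvg_mu => //.
    - by apply: mufin; exact: mD.
    - by rewrite DE; exact: measurableD.
    - move=> m n mn; apply/subsetPset => y [Uy nCy]; split => // Cmy.
      apply: nCy; move: Cmy; rewrite -!bigcup_mkord => -[i /= im Ci].
      by exists i => //=; exact: (leq_trans im).
  have lt_e : (mu (\bigcup_n U n `\` \bigcup_n C n) < e%:E)%E.
    apply: (@le_lt_trans _ _ (e / 2)%:E); last by rewrite lte_fin; lra.
    apply: (@le_trans _ _ (\sum_(n <oo) mu (U n `\` C n))%E).
      apply: measure_sigma_subadditive => //.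
      - by move=> n; exact: measurableD.
      - exact: measurableD.
      - move=> y [[n _ Uny] nCy]; exists n => //; split => // Cny.
        by apply: nCy; exists n.
    apply: (le_trans _ (@epsilon_trick0 R (e / 2) xpredT _)); last by lra.
    apply: lee_nneseries => // n _.
    by apply: ltW; have [] := HCU n.
  have [n _ /(_ n (leqnn n)) nD] := cD _ (open_ereal_lt' lt_e).
  exists (\big[setU/set0]_(i < n) C i), (\bigcup_n U n); split => //.
  + by rewrite -bigcup_mkord; apply: closed_bigcup => // i _; have [] := HCU i.
  + by apply: bigcup_open => i _; have [] := HCU i.
  + by rewrite -bigcup_mkord => y [i _ Ciy]; exists i => //; have [_ _ + _ _] := HCU i; apply.
  + by move=> y [i _ Aiy]; exists i => //; have [_ _ _ + _] := HCU i; apply.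
Qed.

(** * Comparison of measures through their one-sided derivatives *)

Lemma nbhs_itvco (R : realType) (A : set R) (y : R) : nbhs y A ->
  exists2 h : R, 0 < h & forall t, t <= h -> `[y, (y + t)%R[ `<=` A.
Proof.
move=> /nbhs_ballP[r /= r0 rA]; exists (r / 2); first by rewrite divr_gt0.
move=> t tr z/=; rewrite in_itv/= => /andP[yz zt]; apply: rA.
by rewrite /ball/= ltr_norml; lra.
Qed.

Section right_interval_comparison.
Context {R : realType}.
Variables mu nu : {measure set R -> \bar R}.

(* Continuous induction on the right end point [b]: the set of good [b] is
   stable under small steps to the right by hypothesis, and under suprema
   because half-open intervals increase to [[a, sup[]. *)
Lemma le_measure_continuous_induction (K U : set R) :
  measurable K -> measurable U ->
  (forall y, exists2 h : R, 0 < h & forall t : R, 0 < t <= h ->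
    (mu (K `&` `[y, (y + t)%R[) <= nu (U `&` `[y, (y + t)%R[))%E) ->
  forall a b, a <= b -> (mu (K `&` `[a, b[) <= nu (U `&` `[a, b[))%E.
Proof.
move=> mK mU loc a b ab.
have mI (A : set R) x y : measurable A -> measurable (A `&` `[x, y[).
  by move=> mA; apply: measurableI => //; exact: measurable_itv.
pose good t := (mu (K `&` `[a, t[) <= nu (U `&` `[a, t[))%E.
pose S : set R := [set t | a <= t <= b /\ good t].
have Sa : S a.
  by split; [rewrite lexx ab|rewrite /good set_itvco0 ?lexx// !setI0 !measure0].
have hS : has_sup S by split; [exists a|exists b => t [/andP[]]].
set c := sup S.
have ac : a <= c by apply: sup_ubound => //; case: hS.
have cb : c <= b by apply: ge_sup => //; [exists a|move=> t [/andP[]]].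
have gc : good c.
  have cE : K `&` `[a, c[ = \bigcup_n (K `&` `[a, c - n.+1%:R^-1[).
    rewrite -setI_bigcupr; congr (_ `&` _); apply/seteqP; split => z/=.
      rewrite in_itv/= => /andP[az zc]; have [n nc] := ltr_add_invr zc.
      by exists n => //=; rewrite in_itv/= az/= ltrBrDr.
    move=> [n _] /=; rewrite !in_itv/= => /andP[-> zc]/=.
    by rewrite (lt_le_trans zc)// gerBl invr_ge0.
  rewrite /good cE.
  have := @nondecreasing_cvg_mu _ _ _ mu (fun n => K `&` `[a, c - n.+1%:R^-1[).
  move=> /(_ (fun=> mI _ _ _ mK)) Hc.
  apply: (cvge_to_le (Hc _ _)).
  - by apply: bigcupT_measurable => n; exact: mI.
  - move=> m n mn; apply/subsetPset => z [Kz]/=; rewrite in_itv/= => /andP[az zm].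
    split => //=; rewrite in_itv/= az/= (lt_le_trans zm)// lerB//.
    by rewrite lef_pV2 ?posrE ?ltr0n// ler_nat.
  apply: nearW => n /=.
  have [t St tc] : exists2 t, S t & c - n.+1%:R^-1 < t.
    by apply: sup_adherent => //; rewrite invr_gt0.
  have [_ gt] := St.
  apply: (le_trans _ (le_trans gt _)); apply: le_measure; rewrite ?inE//;
    try exact: mI; apply: setIS => z/=; rewrite !in_itv/= => /andP[-> zt]/=.
    by apply: lt_trans tc.
  by apply: lt_le_trans zt _; apply: sup_ubound => //; case: hS.
suff /eqP cbE : c == b by rewrite -cbE.
rewrite eq_le cb/= leNgt; apply/negP => cltb.
have [h h0 hc] := loc c.
pose t := Num.min h (b - c).
have t0 : 0 < t by rewrite lt_min h0 subr_gt0.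
have splitE (A : set R) : A `&` `[a, c + t[ = (A `&` `[a, c[) `|` (A `&` `[c, c + t[).
  rewrite -setIUr; congr (_ `&` _); apply/seteqP; split => z/=; rewrite !in_itv/=.
    by move=> /andP[-> ->]/=; rewrite andbT; have [?|?] := ltP z c; [left|right].
  by move=> [/andP[-> zc]|/andP[cz ->]]/=; [lra|rewrite (le_trans ac)].
have disj (A : set R) : (A `&` `[a, c[) `&` (A `&` `[c, c + t[) = set0.
  rewrite -subset0 => z [[_]]/=; rewrite in_itv/= => /andP[_ zc] [_].
  by rewrite in_itv/= leNgt zc.
have : S (c + t).
  split.
    have : t <= b - c by rewrite ge_min lexx orbT.
    by move=> tbc; apply/andP; split; lra.
  rewrite /good !splitE !measureU//; try exact: mI.
  by apply: leeD => //; apply: hc; rewrite t0 ge_min lexx.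
move=> /(sup_ubound hS.2); rewrite -/c; lra.
Qed.

(** Replacing [E] by a closed [K] inside it and an open [U] around it makes the comparison local at
    every point: near a point of [K] short intervals lie in [U] and the hypothesis applies, near any
    other point they miss [K]. Regularity then closes the gaps between [K], [E] and [U]. *)
Lemma le_measure_right_itv (E : set R) :
  (mu setT < +oo)%E -> (nu setT < +oo)%E -> measurable E ->
  (forall y, E y -> exists2 h : R, 0 < h & forall t : R, 0 < t <= h ->
    (mu `[y, (y + t)%R[%classic <= nu `[y, (y + t)%R[%classic)%E) ->
  (mu E <= nu E)%E.
Proof.
move=> muT nuT mE H.
have KU (K U : set R) : closed K -> open U -> K `<=` E -> E `<=` U ->
    (mu K <= nu U)%E.
  move=> cK oU KE EU.
  have mK := closed_measurable cK; have mU := open_measurable oU.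
  have loc y : exists2 h : R, 0 < h & forall t : R, 0 < t <= h ->
      (mu (K `&` `[y, (y + t)%R[) <= nu (U `&` `[y, (y + t)%R[))%E.
    have [Ky|nKy] := pselect (K y).
      have Uy : U y by apply/EU/KE.
      have [h h0 hU] := nbhs_itvco _ _ _ (open_nbhs_nbhs (conj oU Uy)).
      have [h' h'0 h'E] := H _ (KE _ Ky).
      exists (Num.min h h'); first by rewrite lt_min h0.
      move=> t; rewrite le_min => /andP[t0 /andP[th th']].
      rewrite (setIidr (hU _ th)).
      apply: le_trans (h'E t _); last by rewrite t0.
      by apply: measureIr => //; exact: measurable_itv.
    have oK : open (~` K) by rewrite openC.
    have [h h0 hK] := nbhs_itvco _ _ _ (open_nbhs_nbhs (conj oK nKy)).
    exists h => // t /andP[_ /hK] /subsets_disjoint; rewrite setCK setIC => ->.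
    by rewrite measure0.
  (* Continuous induction works on bounded intervals, so [K] is exhausted by bounded pieces. *)
  have KE' : K = \bigcup_n (K `&` `[- n%:R, n%:R[).
    rewrite -setI_bigcupr (_ : \bigcup__ _ = setT) ?setIT// -subTset => z _.
    have [n zn] : exists n, `|z| < n%:R by exists (Num.bound `|z|); exact: archi_boundP.
    by exists n => //=; rewrite in_itv/=; move: zn; rewrite ltr_norml => /andP[/ltW -> ->].
  rewrite KE'.
  have mI n : measurable (K `&` `[- n%:R, n%:R[).
    by apply: measurableI => //; exact: measurable_itv.
  have Hc := @nondecreasing_cvg_mu _ _ _ mu (fun n => K `&` `[- n%:R, n%:R[)
    mI (bigcupT_measurable _ mI).
  apply: (cvge_to_le (Hc _)).
    move=> m n mn; apply/subsetPset => z [Kz]/=; rewrite in_itv/= => /andP[az zm].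
    have mn' : (m%:R : R) <= n%:R by rewrite ler_nat.
    split => //=; rewrite in_itv/=; lra.
  apply: nearW => n /=.
  apply: (le_trans (le_measure_continuous_induction _ _ mK mU loc _ _ _)).
    by have : 0 <= n%:R :> R by []; lra.
  by apply: measureIl => //; exact: measurable_itv.
apply/lee_addgt0Pr => e e0.
have e20 : 0 < e / 2 by rewrite divr_gt0.
(* [K] approximates [E] from inside for [mu] and [U] from outside for [nu]; [U1] and [K2] serve only
   to bound the two errors. *)
have [K [U1 [cK oU1 KE EU1 muK]]] := finite_measure_regular _ muT _ mE _ e20.
have [K2 [U [cK2 oU K2E EU nuU]]] := finite_measure_regular _ nuT _ mE _ e20.
have mK := closed_measurable cK; have mU := open_measurable oU.
have mU1 := open_measurable oU1; have mK2 := closed_measurable cK2.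
apply: (@le_trans _ _ (mu K + (e / 2)%:E)%E).
  rewrite (measureDI mu mE mK) addeC setIC (setIidl KE); apply: leeD => //.
  apply/ltW; apply: le_lt_trans muK; apply: le_measure; rewrite ?inE//.
  - exact: measurableD.
  - exact: measurableD.
  - by move=> z [/EU1].
have -> : (nu E + e%:E = nu E + (e / 2)%:E + (e / 2)%:E)%E.
  by rewrite -addeA -EFinD -splitr.
apply: leeD => //.
apply: (le_trans (KU _ _ cK oU KE EU)).
rewrite (measureDI nu mU mE) addeC setIC (setIidl EU); apply: leeD => //.
apply/ltW; apply: le_lt_trans nuU; apply: le_measure; rewrite ?inE//.
- exact: measurableD.
- exact: measurableD.
- by move=> z [Uz nE]; split => // /K2E.
Qed.

End right_interval_comparison.

(** * Partition by half-open level bands of a function *)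

Section level_sets.
Context {R : realType}.
Variables (B : set R) (b : R -> R) (delta : R).
Hypotheses (mB : measurable B) (mb : measurable_fun B b).
Hypotheses (b0 : forall y, B y -> 0 <= b y) (delta0 : 0 < delta).

Definition level_set (n : nat) : set R :=
  B `&` b @^-1` `[n%:R * delta, n.+1%:R * delta[.

Lemma measurable_level_set n : measurable (level_set n).
Proof. by apply: mb => //; exact: measurable_itv. Qed.

Lemma bigcup_level_set : \bigcup_n level_set n = B.
Proof.
apply/seteqP; split => [y [n _ []]//|y By].
have q0 : 0 <= b y / delta by rewrite divr_ge0 ?b0// ltW.
exists (Num.truncn (b y / delta)) => //; split => //=; rewrite in_itv/=.
have /andP[h1 h2] := truncn_itv q0.
by rewrite -ler_pdivlMr// h1 -ltr_pdivrMr.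
Qed.

Lemma trivIset_level_set : trivIset setT level_set.
Proof.
apply/trivIsetP => i j _ _; apply: contraNeq => /eqP/eqP/set0P[y [[_]]]/=.
rewrite in_itv/= => /andP[i1 i2] [_]/=; rewrite in_itv/= => /andP[j1 j2].
have := le_lt_trans i1 j2; rewrite ltr_pM2r// ltr_nat ltnS => ij.
have := le_lt_trans j1 i2; rewrite ltr_pM2r// ltr_nat ltnS => ji.
by rewrite eqn_leq ij ji.
Qed.

End level_sets.

(** * Integrating pointwise density bounds *)

Section density_comparison.
Context {R : realType}.
Variables mu nu : {measure set R -> \bar R}.
Hypotheses (muT : (mu setT < +oo)%E) (nuT : (nu setT < +oo)%E).
Variables (B : set R) (b : R -> R).
Hypotheses (mB : measurable B) (mb : measurable_fun B b).
Hypothesis b0 : forall y, B y -> 0 <= b y.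

Let mscale_lty (m : {measure set R -> \bar R}) (r : {nonneg R}) :
  (m setT < +oo)%E -> (mscale r m setT < +oo)%E.
Proof.
move=> mT; rewrite /mscale/=; apply: lte_mul_pinfty => //.
Qed.

Let fin_nu A : measurable A -> nu A \is a fin_num.
Proof. by move=> mA; exact: (lty_fin_num_fun nuT). Qed.

(** On band [n] the density is bounded by the constant [n.+1%:R * delta], so there the interval
    comparison applies to [mu] and a multiple of [nu]. That constant exceeds [b] by at most [delta]
    on the band, and the total loss is at most [delta] times the mass of [B]. *)
Lemma measure_le_integral_density :
  (forall y, B y -> exists2 h : R, 0 < h & forall t : R, 0 < t <= h ->
    (mu `[y, (y + t)%R[%classic <= (b y)%:E * nu `[y, (y + t)%R[%classic)%E) ->
  (mu B <= \int[nu]_(y in B) (b y)%:E)%E.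
Proof.
move=> H; apply/lee_addgt0Pr => e e0.
have nuT0 : 0 <= fine (nu setT) by apply: fine_ge0.
(* The added [1] keeps the denominator positive even when [nu] vanishes; [delta * nu B] stays below
   [e]. *)
pose delta := e / (fine (nu setT) + 1).
have d0 : 0 < delta by rewrite divr_gt0// ltr_wpDl.
have mD := measurable_level_set _ _ delta mB mb.
have UD := bigcup_level_set _ _ _ b0 d0.
have tD := trivIset_level_set B b _ d0.
have mbd : measurable_fun B (fun y => (b y + delta)%:E).
  by apply/measurable_EFinP; exact: measurable_funD.
apply: (@le_trans _ _ (\int[nu]_(y in B) (b y + delta)%:E)%E); last first.
  rewrite (eq_integral (fun y => (b y)%:E + cst delta%:E y)%E); last by [].
  rewrite ge0_integralD//; [|exact/measurable_EFinP|
    by move=> y By; rewrite lee_fin ltW].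
  rewrite integral_cst// leeD2l// -(fineK (fin_nu _ mB)) -EFinM lee_fin.
  rewrite /delta mulrAC ler_pdivrMr ?ltr_wpDl// ler_pM2l//.
  apply: (@le_trans _ _ (fine (nu setT))); last by rewrite lerDl.
  by apply: fine_le; rewrite ?fin_nu//; apply: le_measure; rewrite ?inE.
rewrite -{1}UD (measure_semi_bigcup _ mD tD); last by rewrite UD.
have := @ge0_integral_bigcup _ _ _ nu _ (fun y => (b y + delta)%:E) mD.
rewrite /= UD => -> //; last by move=> y By; rewrite lee_fin addr_ge0 ?b0// ltW.
apply: lee_nneseries => // n _.
have r0 : 0 <= n.+1%:R * delta by rewrite mulr_ge0// ltW.
apply: (@le_trans _ _ (mscale (NngNum r0) nu (level_set B b delta n))).
  apply: le_measure_right_itv => //; first exact: mscale_lty.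
  move=> y [By]/=; rewrite in_itv/= => /andP[_ byn].
  have [h h0 Hy] := H y By; exists h => // t th; apply: (le_trans (Hy t th)).
  by rewrite /mscale/= lee_wpmul2r// lee_fin ltW.
rewrite /mscale/= -integral_cst//; apply: ge0_le_integral => //.
- by apply: measurable_funS mbd => // y [].
- move=> y [By]/=; rewrite in_itv/= => /andP[nby _].
  by rewrite lee_fin -natr1 mulrDl mul1r lerD2r.
Qed.

(** Dual argument: the lower end [n%:R * delta] of each band enters the interval comparison, and the
    excess [delta] up to the upper end is summed separately. Finiteness of the integral is a
    consequence, so the error is added on the side of [mu]. *)
Lemma integral_density_le_measure :
  (forall y, B y -> exists2 h : R, 0 < h & forall t : R, 0 < t <= h ->
    ((b y)%:E * nu `[y, (y + t)%R[%classic <= mu `[y, (y + t)%R[%classic)%E) ->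
  (\int[nu]_(y in B) (b y)%:E <= mu B)%E.
Proof.
move=> H; apply/lee_addgt0Pr => e e0.
have nuT0 : 0 <= fine (nu setT) by apply: fine_ge0.
pose delta := e / (fine (nu setT) + 1).
have d0 : 0 < delta by rewrite divr_gt0// ltr_wpDl.
have mD := measurable_level_set _ _ delta mB mb.
have UD := bigcup_level_set _ _ _ b0 d0.
have tD := trivIset_level_set B b _ d0.
have nuE : (\sum_(n <oo) delta%:E * nu (level_set B b delta n) <= e%:E)%E.
  rewrite nneseriesZl// -(measure_semi_bigcup _ mD tD) UD//.
  rewrite -(fineK (fin_nu _ mB)) -EFinM lee_fin.
  rewrite /delta mulrAC ler_pdivrMr ?ltr_wpDl// ler_pM2l//.
  apply: (@le_trans _ _ (fine (nu setT))); last by rewrite lerDl.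
  by apply: fine_le; rewrite ?fin_nu//; apply: le_measure; rewrite ?inE.
apply: (@le_trans _ _ (mu B + \sum_(n <oo) delta%:E * nu (level_set B b delta n))%E);
  last by rewrite leeD2l.
rewrite -{2}UD (measure_semi_bigcup _ mD tD) ?UD// -nneseriesD//; last first.
  by move=> n _ _; rewrite mule_ge0// lee_fin ltW.
have := @ge0_integral_bigcup _ _ _ nu _ (fun y => (b y)%:E) mD.
rewrite /= UD => ->; [|exact/measurable_EFinP|by move=> y /b0; rewrite lee_fin|by []].
apply: lee_nneseries => [n _ _|n _].
  by apply: integral_ge0 => y [By _]; rewrite lee_fin b0.
have r0 : 0 <= n%:R * delta by rewrite mulr_ge0// ltW.
apply: (@le_trans _ _ ((n.+1%:R * delta)%:E * nu (level_set B b delta n))%E).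
  rewrite -integral_cst//; apply: ge0_le_integral => //.
  - by move=> y [By _]; rewrite lee_fin b0.
  - by apply/measurable_EFinP; apply: measurable_funS mb => // y [].
  - by move=> y [By]/=; rewrite in_itv/= => /andP[_ /ltW].
rewrite -natr1 mulrDl mul1r EFinD ge0_muleDl ?lee_fin//; last exact: ltW.
apply: leeD => //.
suff : (mscale (NngNum r0) nu (level_set B b delta n) <= mu (level_set B b delta n))%E.
  by [].
apply: le_measure_right_itv => //; first exact: mscale_lty.
move=> y [By]/=; rewrite in_itv/= => /andP[nby _].
have [h h0 Hy] := H y By; exists h => // t th; apply: le_trans (Hy t th).
by rewrite /mscale/= lee_wpmul2r// lee_fin.
Qed.

End density_comparison.

(** * Conditional dependence *)

Section event_law.
Context {R : realType} {d : measure_display} {T : measurableType d}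
  {P : probability T R}.
Variables (Y : {RV P >-> R}) (A : set T) (mA : measurable A).
Variables (B : set R) (b : R -> R).
Hypotheses (mB : measurable B) (mb : measurable_fun B b).
Hypothesis b0 : forall y, B y -> 0 <= b y.

(** An opaque measure for P(A, Y in .): later proofs use only its values, by rewriting with the
    equation. *)
Lemma event_law : exists m : {measure set R -> \bar R},
  (m : set R -> \bar R) = pushforward (mrestr P mA) Y.
Proof. by unshelve eexists (pushforward (mrestr P mA) Y : {measure set R -> \bar R}). Qed.

Let preimage_itv y (t : R) :
  Y @^-1` `[y, y + t[%classic = [set w | y <= Y w < y + t].
Proof. by apply/seteqP; split => w/=; rewrite in_itv. Qed.

Lemma prob_event_le_integral :
  (forall y, B y -> exists2 h : R, 0 < h & forall t : R, 0 < t <= h ->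
    (P (A `&` [set w | (y <= Y w < y + t)%R]) <=
     (b y)%:E * P [set w | (y <= Y w < y + t)%R])%E) ->
  (P (A `&` Y @^-1` B) <= \int[P]_(w in Y @^-1` B) (b (Y w))%:E)%E.
Proof.
move=> H; have [m mE] := event_law.
have := @measure_le_integral_density R m (distribution P Y).
rewrite mE /pushforward/= /mrestr preimage_setT setTI => /(_ _ _ B b mB mb b0).
rewrite setIC ge0_integral_pushforward//; last 2 first.
- exact/measurable_EFinP.
- by move=> y /set_mem /b0; rewrite lee_fin.
apply.
- by rewrite (le_lt_trans (probability_le1 P mA))// ltry.
- by rewrite probability_setT ltry.
- move=> y By; have [h h0 Hh] := H y By; exists h => // t th.
  by rewrite preimage_itv setIC; exact: Hh.
Qed.

Lemma integral_le_prob_event :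
  (forall y, B y -> exists2 h : R, 0 < h & forall t : R, 0 < t <= h ->
    ((b y)%:E * P [set w | (y <= Y w < y + t)%R] <=
     P (A `&` [set w | (y <= Y w < y + t)%R]))%E) ->
  (\int[P]_(w in Y @^-1` B) (b (Y w))%:E <= P (A `&` Y @^-1` B))%E.
Proof.
move=> H; have [m mE] := event_law.
have := @integral_density_le_measure R m (distribution P Y).
rewrite mE /pushforward/= /mrestr preimage_setT setTI => /(_ _ _ B b mB mb b0).
rewrite setIC ge0_integral_pushforward//; last 2 first.
- exact/measurable_EFinP.
- by move=> y /set_mem /b0; rewrite lee_fin.
apply.
- by rewrite (le_lt_trans (probability_le1 P mA))// ltry.
- by rewrite probability_setT ltry.
- move=> y By; have [h h0 Hh] := H y By; exists h => // t th.
  by rewrite preimage_itv setIC; exact: Hh.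
Qed.

End event_law.

Lemma at_right_near {R : realType} (a : R) (Q : R -> Prop) :
  (\forall t \near a^'+, Q t) ->
  exists2 h, 0 < h & forall t, 0 < t <= h -> Q (a + t).
Proof.
move=> /nbhs_ballP[r /= r0 rQ]; exists (r / 2); first by rewrite divr_gt0.
move=> t /andP[t0 tr]; apply: rQ => /=; last by rewrite ltrDl.
by rewrite /ball/= ltr_norml; lra.
Qed.

Section tail.
Context {R : realType} {d : measure_display} {T : measurableType d}.
Variable P : probability T R.

Lemma measurable_gt (Z : {RV P >-> R}) x : measurable [set w | x < Z w].
Proof.
rewrite (_ : mkset _ = Z @^-1` `]x, +oo[%classic); last first.
  by apply/seteqP; split => w/=; rewrite in_itv/= andbT.
by apply: measurable_funPTI; exact: measurable_itv.
Qed.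

Lemma tailPE (Z : {RV P >-> R}) x : P [set w | x < Z w] = (tailP P Z x)%:E.
Proof. by rewrite /tailP fineK// fin_num_measure//; exact: measurable_gt. Qed.

Lemma tailP_nonincreasing (Z : {RV P >-> R}) : nonincreasing_fun (tailP P Z).
Proof.
move=> x y xy; rewrite -lee_fin -!tailPE; apply: le_measure; rewrite ?inE//.
- exact: measurable_gt.
- exact: measurable_gt.
- by move=> w /=; exact: le_lt_trans.
Qed.

Lemma measurable_itv_event (Y : {RV P >-> R}) (y t : R) :
  measurable [set w | y <= Y w < y + t].
Proof.
rewrite (_ : mkset _ = Y @^-1` `[y, y + t[%classic); last first.
  by apply/seteqP; split => w/=; rewrite in_itv.
by apply: measurable_funPTI; exact: measurable_itv.
Qed.

(** On [DY] the limit satisfies the bounds strictly, so the quotients satisfy them for small [t].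
    Off [DY] a neighbourhood of [y] is null for [Y] and every term vanishes. The threshold [x0] is
    uniform in [y]; only [h] depends on it. *)
Lemma CD_local_bounds (X Y : {RV P >-> R}) (s : R -> R) :
  (forall x, 0 < tailP P X x) -> CD P X Y s ->
  forall e : R, 0 < e -> exists x0 : R, forall u, x0 < u -> forall y : R, 0 < y ->
  exists2 h : R, 0 < h & forall t : R, 0 < t <= h ->
    (((1 - e) * tailP P X u * s y)%:E * P [set w | (y <= Y w < y + t)%R] <=
       P ([set w | (u < X w)%R] `&` [set w | (y <= Y w < y + t)%R]))%E /\
    (P ([set w | (u < X w)%R] `&` [set w | (y <= Y w < y + t)%R]) <=
     ((1 + e) * tailP P X u * s y)%:E * P [set w | (y <= Y w < y + t)%R])%E.
Proof.
move=> F0 [s0 [ms [ex unif]]] e e0.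
(* Halving the tolerance is what makes the bounds on the limit strict. *)
have e20 : 0 < e / 2 by rewrite divr_gt0.
have [x0 Hx0] := unif _ e20; exists x0 => u xu y y0.
have mJ t : measurable ([set w | u < X w] `&` [set w | (y <= Y w < y + t)%R]).
  by apply: measurableI; [exact: measurable_gt|exact: measurable_itv_event].
have [yD|/not_andP[//|/existsNP[h /not_implyP[h0 /negP]]]] := pselect (DY P Y y); last first.
  rewrite -leNgt measure_le0 => /eqP null.
  have mN : measurable [set w | y - h < Y w < y + h].
    rewrite (_ : mkset _ = Y @^-1` `]y - h, y + h[%classic); last first.
      by apply/seteqP; split => w/=; rewrite in_itv.
    by apply: measurable_funPTI; exact: measurable_itv.
  exists h => // t /andP[t0 th].
  have -> : P [set w | y <= Y w < y + t] = 0%E.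
    apply: subset_measure0 null => //; first exact: measurable_itv_event.
    by move=> w/=; lra.
  have -> : P ([set w | (u < X w)%R] `&` [set w | y <= Y w < y + t]) = 0%E.
    by apply: subset_measure0 null => // w [_]/=; lra.
  by rewrite !mule0.
have := ex u y yD; rewrite /cond_tail_exists => exy.
have := Hx0 u xu y yD; set c := cond_tail P X Y u y => cbound.
have Fs0 : 0 < tailP P X u * s y by rewrite mulr_gt0// s0// ltW.
move: cbound; rewrite ler_norml => /andP[].
rewrite lerBrDr ler_pdivlMr// => c1; rewrite lerBlDr ler_pdivrMr// => c2.
have cgt : (1 - e) * tailP P X u * s y < c.
  by apply: lt_le_trans c1; rewrite -mulrA ltr_pM2r//; lra.
have clt : c < (1 + e) * tailP P X u * s y.
  by apply: (le_lt_trans c2); rewrite -[ltRHS]mulrA ltr_pM2r//; lra.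
have [h h0 hQ] := at_right_near _ _ (filterI (cvgr_gt c exy _ cgt) (cvgr_lt c exy _ clt)).
exists h => // t th; have := hQ t th; rewrite add0r /cond_ratio => -[].
have -> : [set w | u < X w /\ y <= Y w < y + t] =
  [set w | u < X w] `&` [set w | (y <= Y w < y + t)%R] by [].
have fJ := fin_num_measure P _ (mJ t).
have fI := fin_num_measure P _ (measurable_itv_event Y y t).
rewrite -[in X in _ -> _ -> X](fineK fJ) -[in X in _ -> _ -> X](fineK fI).
set j := fine (P ([set w | (u < X w)%R] `&` _)); set i := fine (P [set w | y <= Y w < y + t]).
have i0 : 0 <= i by apply: fine_ge0.
have j0 : 0 <= j by apply: fine_ge0.
have ji : j <= i.
  apply: fine_le => //; apply: le_measure; rewrite ?inE//; first exact: measurable_itv_event.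
rewrite -!EFinM !lee_fin.
(* If the interval is null, the quotient is 0 by convention and says nothing; [j <= i] settles this
   case. *)
have [i00|ine0] := eqVneq i 0.
  by rewrite i00 !mulr0 => _ _; split => //; rewrite -i00.
have {ine0 i0}i0 : 0 < i by rewrite lt_neqAle eq_sym ine0.
by rewrite ltr_pdivlMr// ltr_pdivrMr// => /ltW ? /ltW.
Qed.

End tail.

(** * The tail of the product *)

Lemma near_pinftyP {R : realType} (Q : R -> Prop) :
  (\forall x \near +oo, Q x) -> exists M : R, forall x, M < x -> Q x.
Proof. by move=> [M [_ MQ]]; exists M. Qed.

(** This absorbs the discrepancy between [x / Y] and [x / y] when [Y] lies slightly to the right of
    [y]: the limit of the ratio is [rho] to the power [alpha], which is near 1 for [rho] near 1. *)
Lemma regvar_tail_shift {R : realType} (F : R -> R) (alpha : R) :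
  0 <= alpha -> (forall x, 0 < F x) -> regvar_tail F alpha ->
  forall e : R, 0 < e -> exists2 rho : R, 1 < rho &
    exists z1 : R, forall z, z1 < z -> F (z / rho) <= (1 + e) * F z.
Proof.
move=> a0 F0 rv e e0.
have e1 : 1 < 1 + e / 2 by lra.
have p0 : 0 < (alpha + 1)^-1 by rewrite invr_gt0; lra.
(* The exponent [(alpha + 1)^-1] covers [alpha = 0] as well: [rho] to the power [alpha] is then at
   most [1 + e / 2]. *)
pose rho := (1 + e / 2) `^ (alpha + 1)^-1.
have rho1 : 1 < rho.
  have := @gt0_ltr_powR R _ p0 1 (1 + e / 2).
  by rewrite powR1 !nnegrE; apply => //; lra.
have rho0 : 0 < rho by lra.
exists rho => //.
have rhoa : rho `^ alpha < 1 + e.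
  rewrite -powRrM; apply: (@le_lt_trans _ _ (1 + e / 2)); last by lra.
  rewrite -[leRHS]powRr1; last by lra.
  rewrite ler_powR//; first by lra.
  by rewrite mulrC ler_pdivrMr; lra.
have rhoV0 : 0 < rho^-1 by rewrite invr_gt0.
have /cvgr_lt/(_ (1 + e)) := rv _ rhoV0.
rewrite -powR_inv1 ?(ltW rho0)// -powRrM mulN1r opprK => /(_ rhoa) /near_pinftyP[z1 H].
exists z1 => z /H; rewrite powR_inv1 ?(ltW rho0)// ltr_pdivrMr//; exact: ltW.
Qed.

Section product_tail.
Context {R : realType} {d : measure_display} {T : measurableType d}
  {P : probability T R}.
Variables (X Y : {RV P >-> R}) (s : R -> R).
Hypothesis F0 : forall x, 0 < tailP P X x.
Hypothesis Y0 : forall w, 0 < Y w.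
Hypothesis cd : CD P X Y s.

Lemma measurable_comp_pos {d' : measure_display} {U : measurableType d'}
  (f : R -> U) :
  measurable_fun (`]0, +oo[%classic : set R) f -> measurable_fun setT (f \o Y).
Proof.
move=> mf; apply: (measurable_comp _ _ mf) => //.
by move=> _ [w _ <-]/=; rewrite in_itv/= Y0.
Qed.

Lemma measurable_weight : measurable_fun (`]0, +oo[%classic : set R) s.
Proof.
case: cd => _ [ms _]; apply: measurable_funS ms; first exact: measurable_itv.
by move=> y /=; rewrite !in_itv/= !andbT => /ltW.
Qed.

Lemma weight_gt0 y : 0 < y -> 0 < s y.
Proof. by move=> /ltW; case: cd => + _; apply. Qed.

(** At one fixed level [u] beyond the threshold of conditional dependence, half of
    [tailP P X u * s y] bounds the density of P(X > u, Y in .) from below, so its integral is at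
    most P(X > u). *)
Lemma integral_weight_lty : (\int[P]_w (s (Y w))%:E < +oo)%E.
Proof.
have h0 : 0 < 2^-1 :> R by rewrite invr_gt0.
have [x0 H] := CD_local_bounds P X Y s F0 cd _ h0.
pose u := x0 + 1; have xu : x0 < u by rewrite ltrDl.
pose k := (1 - 2^-1) * tailP P X u.
have k0 : 0 < k by rewrite mulr_gt0//; lra.
have mb : measurable_fun (`]0, +oo[%classic : set R) (fun y => k * s y).
  by apply: measurable_funM => //; exact: measurable_weight.
have := @integral_le_prob_event _ _ _ P Y _ (measurable_gt P X u) _ _
  (measurable_itv _) mb.
have -> : Y @^-1` `]0, +oo[%classic = setT.
  by rewrite -subTset => w _ /=; rewrite in_itv/= Y0.
move=> /(_ _ _)/(le_lt_trans (y := _)) HH.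
rewrite ltNge leye_eq; apply/negP => /eqP sy.
have : (\int[P]_w (k * s (Y w))%:E < +oo)%E.
  apply: HH.
  - move=> y /=; rewrite in_itv/= andbT => y0.
    by rewrite mulr_ge0 ?ltW// weight_gt0.
  - move=> y /=; rewrite in_itv/= andbT => y0.
    have [h h0' Hh] := H u xu y y0; exists h => // t /Hh[+ _]; exact.
  - by rewrite setIT tailPE ltry.
under eq_integral do rewrite EFinM.
rewrite ge0_integralZl_EFin//.
- by rewrite sy gt0_muley// lte_fin.
- by move=> w _; rewrite lee_fin ltW// weight_gt0.
- by apply/measurable_EFinP; exact: (measurable_comp_pos _ measurable_weight).
- exact: ltW.
Qed.

Lemma measurable_kernel x :
  measurable_fun (`]0, +oo[%classic : set R) (fun y => tailP P X (x / y) * s y).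
Proof.
apply: measurable_funM; last exact: measurable_weight.
have mF := nonincreasing_measurable measurableT (tailP_nonincreasing P X).
apply: (eq_measurable_fun (tailP P X \o (fun y => x * (y `^ (-1))))).
  move=> y /set_mem/=; rewrite in_itv/= andbT => y0.
  by rewrite powR_inv1// ltW.
apply: measurableT_comp => //; apply: measurable_funM => //.
by apply: measurable_funTS; exact: measurable_powR.
Qed.

(** The value that P(XY > x, Y <= c) would take if X > x / y had conditional probability exactly
    [tailP P X (x / y) * s y] given Y = y. *)
Definition truncated_mean (x c : R) : \bar R :=
  (\int[P]_(w in [set w | (Y w <= c)%R]) (tailP P X (x / Y w) * s (Y w))%:E)%E.

Lemma measurable_le c : measurable [set w | Y w <= c].
Proof.
rewrite (_ : mkset _ = Y @^-1` `]-oo, c]%classic); last first.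
  by apply/seteqP; split => w/=; rewrite in_itv.
by apply: measurable_funPTI; exact: measurable_itv.
Qed.

Lemma measurable_prod_gt x : measurable [set w | x < X w * Y w].
Proof.
rewrite (_ : mkset _ = (X \* Y) @^-1` `]x, +oo[%classic); last first.
  by apply/seteqP; split => w/=; rewrite in_itv/= andbT.
rewrite -[X in measurable X]setTI.
by apply: measurable_funM => //; exact: measurable_itv.
Qed.

(** When Y lies in [y, y + t[, the event XY > x contains X > x / y, and it is contained in X > x /
    (rho y) as soon as y + t <= rho y. For y <= c both levels are large once [x / c] is, hence a
    threshold on [x / c] alone. *)
Lemma product_tail_bounds (alpha : R) : 0 <= alpha -> regvar_tail (tailP P X) alpha ->
  forall e : R, 0 < e < 1 -> exists z0 : R, forall x c : R, 0 < x -> 0 < c ->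
    z0 < x / c ->
    ((1 - e)%:E * truncated_mean x c <=
      P ([set w | (x < X w * Y w)%R] `&` [set w | (Y w <= c)%R]))%E /\
    (P ([set w | (x < X w * Y w)%R] `&` [set w | (Y w <= c)%R]) <=
      (1 + e)%:E * truncated_mean x c)%E.
Proof.
move=> a0 rv e /andP[e0 e1].
(* Two factors [1 + e / 3] arise, from conditional dependence and from the shift by [rho]; their
   product is at most [1 + e]. *)
have e3 : 0 < e / 3 by rewrite divr_gt0.
have [rho rho1 [z1 Hrho]] := regvar_tail_shift _ _ a0 F0 rv _ e3.
have rho0 : 0 < rho by lra.
have [x0 Hx0] := CD_local_bounds P X Y s F0 cd _ e3.
(* [x0] serves the lower bound at level [x / y], [z1] the shift, and [rho * x0] keeps [x / y / rho]
   above [x0]. *)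
exists (Num.max (Num.max x0 z1) (rho * x0)) => x c x_gt0 c0.
rewrite !gt_max => /andP[/andP[xc1 xc2] xc3].
have mB : measurable (`]0, c]%classic : set R) by exact: measurable_itv.
have YB : Y @^-1` `]0, c]%classic = [set w | Y w <= c].
  by apply/seteqP; split => w /=; rewrite in_itv/= Y0.
have xcy y : 0 < y <= c -> x / c <= x / y.
  by move=> /andP[y0 yc]; rewrite ler_pM2l// lef_pV2.
have mk : measurable_fun (`]0, c]%classic : set R) (fun y => tailP P X (x / y) * s y).
  apply: measurable_funS (measurable_kernel x); first exact: measurable_itv.
  by move=> y /=; rewrite !in_itv/= andbT => /andP[].
have k0 y : 0 < y -> 0 <= tailP P X (x / y) * s y.
  by move=> y0; rewrite mulr_ge0 ?ltW// weight_gt0.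
have scaleE (k : R) : 0 <= k ->
    (k%:E * truncated_mean x c =
     \int[P]_(w in Y @^-1` `]0%R, c]%classic) (k * (tailP P X (x / Y w) * s (Y w)))%:E)%E.
  move=> k_ge0; rewrite YB; under eq_integral do rewrite EFinM.
  rewrite ge0_integralZl_EFin//.
  - exact: measurable_le.
  - by move=> w _; rewrite lee_fin k0.
  - apply/measurable_EFinP; apply: measurable_funTS.
    exact: (measurable_comp_pos _ (measurable_kernel x)).
have mA := measurable_prod_gt x.
have p1 : 0 <= 1 - e by lra.
have p2 : 0 <= 1 + e by lra.
rewrite -YB (scaleE _ p1) (scaleE _ p2).
split.
  apply: (integral_le_prob_event Y _ mA _
    (fun y => (1 - e) * (tailP P X (x / y) * s y))) => //.
  - exact: measurable_funM.
  - move=> y /=; rewrite in_itv/= => /andP[y0 yc].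
    by rewrite mulr_ge0 ?k0//; lra.
  - move=> y /=; rewrite in_itv/= => y0c; have /andP[y0 yc] := y0c.
    have xy0 : x0 < x / y by apply: lt_le_trans (xcy _ y0c).
    have [h h0 Hh] := Hx0 _ xy0 _ y0; exists h => // t /Hh[lo _].
    apply: le_trans (le_trans lo _).
      rewrite lee_wpmul2r// lee_fin -mulrA ler_wpM2r ?k0//; lra.
    apply: le_measure; rewrite ?inE.
    + by apply: measurableI; [exact: measurable_gt|exact: measurable_itv_event].
    + by apply: measurableI => //; exact: measurable_itv_event.
    + move=> w [/= xX /andP[yY Yt]]; split => //=; last by rewrite yY.
      have xy : x < X w * y by rewrite -ltr_pdivrMr.
      (* [X] may be negative elsewhere, but [x > 0] excludes this here, so the product increases
         with [Y]. *)
      have X0 : 0 < X w by rewrite -(pmulr_lgt0 _ y0); lra.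
      by apply: (lt_le_trans xy); rewrite ler_pM2l.
apply: (prob_event_le_integral Y _ mA _
  (fun y => (1 + e) * (tailP P X (x / y) * s y))) => //.
- exact: measurable_funM.
- move=> y /=; rewrite in_itv/= => /andP[y0 yc].
  by rewrite mulr_ge0 ?k0//; lra.
- move=> y /=; rewrite in_itv/= => y0c; have /andP[y0 yc] := y0c.
  have xy1 : x0 < x / y / rho.
    by rewrite ltr_pdivlMr// mulrC; apply: lt_le_trans (xcy _ y0c).
  have xy2 : z1 < x / y by apply: lt_le_trans (xcy _ y0c).
  have [h h0 Hh] := Hx0 _ xy1 _ y0.
  (* The second bound ensures [Y w < rho * y] on the interval. *)
  exists (Num.min h ((rho - 1) * y)).
    by rewrite lt_min h0 mulr_gt0// subr_gt0.
  move=> t; rewrite le_min => /andP[t0 /andP[th tr]].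
  have [_ hi] := Hh t (introT andP (conj t0 th)).
  apply: le_trans (le_trans hi _).
    apply: le_measure; rewrite ?inE.
    + by apply: measurableI => //; exact: measurable_itv_event.
    + by apply: measurableI; [exact: measurable_gt|exact: measurable_itv_event].
    + move=> w [/= xX /andP[yY Yt]]; split => //=; last by rewrite yY.
      have X0 : 0 < X w by rewrite -(pmulr_lgt0 _ (Y0 w)); lra.
      rewrite !ltr_pdivrMr// (lt_le_trans xX)// -mulrA ler_pM2l//; lra.
  rewrite lee_wpmul2r// lee_fin mulrA; apply: ler_wpM2r.
    by apply/ltW/weight_gt0.
  apply: (@le_trans _ _ ((1 + e / 3) * ((1 + e / 3) * tailP P X (x / y)))).
    by apply: ler_wpM2l; [lra|exact: Hrho].
  by rewrite mulrA; apply: ler_wpM2r; [exact/ltW|nra].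
Qed.

End product_tail.

(** By regular variation one halving of a large argument multiplies [F] by at most 2 to the power
    [alpha + eps]. Dividing by [y] amounts to repeated halvings, and the final factor, below 2, is
    handled by monotonicity at the cost of the constant. *)
Lemma potter_bound {R : realType} (F : R -> R) (alpha eps : R) :
  0 <= alpha -> 0 < eps -> (forall x, 0 < F x) -> nonincreasing_fun F ->
  regvar_tail F alpha ->
  exists C z1 : R, forall x y, 0 < x -> 1 <= y -> z1 < x / y ->
    F (x / y) <= C * y `^ (alpha + eps) * F x.
Proof.
move=> a0 eps0 F0 Fd rv; pose p := alpha + eps.
have p0 : 0 <= p by rewrite addr_ge0// ltW.
pose A : R := 2 `^ p.
have A0 : 0 <= A by exact: powR_ge0.
have [z1 Hz1] : exists z1 : R, forall z, z1 < z -> F (z / 2) <= A * F z.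
  have h0 : 0 < 2^-1 :> R by rewrite invr_gt0.
  have hA : (2^-1 : R) `^ (- alpha) < A.
    rewrite -powR_inv1// -powRrM mulN1r opprK.
    rewrite /A /p; rewrite powRD; last by rewrite pnatr_eq0 implybT.
    rewrite -[ltLHS]mulr1 ltr_pM2l ?powR_gt0//.
    have := @gt0_ltr_powR R _ eps0 1 2.
    by rewrite powR1 !nnegrE; apply => //; lra.
  have /cvgr_lt/(_ A hA) /near_pinftyP[z1 H] := rv _ h0.
  by exists z1 => z /H; rewrite ltr_pdivrMr// => /ltW.
exists A, z1.
have ind n x y : 0 < x -> 1 <= y -> y < 2 ^+ n -> z1 < x / y ->
    F (x / y) <= A * y `^ p * F x.
  elim: n x y => [|n IH] x y x0 y1; first by rewrite expr0; lra.
  move=> yn z1y; have y0 : 0 < y by lra.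
  have [y2|y2] := ltP y 2.
    apply: (@le_trans _ _ (F (x / 2))).
      by apply: Fd; rewrite ler_pM2l// lef_pV2 ?posrE// ltW.
    apply: (@le_trans _ _ (A * F x)).
      apply: Hz1; apply: (lt_le_trans z1y); rewrite ler_pdivrMr//.
      by rewrite ler_peMr// ltW.
    rewrite ler_wpM2r ?(ltW (F0 x))// ler_peMr//.
    by rewrite -[leLHS](powRr0 y) ler_powR.
  have y20 : 0 < y / 2 by rewrite divr_gt0.
  (* Halving [x] and [y] together leaves the quotient unchanged, so the condition [z1 < x / y]
     survives the induction. *)
  have xE : x / y = (x / 2) / (y / 2) by field; lra.
  rewrite xE; apply: (le_trans (IH _ _ _ _ _ _)).
  - by rewrite divr_gt0.
  - by rewrite ler_pdivlMr// mul1r.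
  - by rewrite ltr_pdivrMr// -exprSr.
  - by rewrite -xE.
  have -> : A * y `^ p * F x = A * (y / 2) `^ p * (A * F x).
    rewrite {2}/A.
    have -> : y `^ p = (y / 2) `^ p * 2 `^ p.
      by rewrite -powRM ?(ltW y20)// divfK// pnatr_eq0.
    by rewrite -!mulrA.
  rewrite ler_wpM2l ?mulr_ge0 ?powR_ge0//; apply: Hz1.
  apply: (lt_le_trans z1y); rewrite ler_pdivrMr//.
  by rewrite ler_peMr// ltW.
move=> x y x0 y1 z1y; apply: (ind (Num.bound y)) => //.
have y0 : 0 <= y by lra.
apply: (lt_trans (archi_boundP y0)).
by rewrite -natrX ltr_nat ltn_expl.
Qed.

(** * Moments of [Y] weighted by [s] *)

Section moments.
Context {R : realType} {d : measure_display} {T : measurableType d}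
  {P : probability T R}.
Variables (X Y : {RV P >-> R}) (s : R -> R).
Hypothesis F0 : forall x, 0 < tailP P X x.
Hypothesis Y0 : forall w, 0 < Y w.
Hypothesis cd : CD P X Y s.

Let sY0 w : 0 < s (Y w). Proof. exact: weight_gt0 cd _ (Y0 w). Qed.

Lemma measurable_moment p :
  measurable_fun [set: T] (fun w => Y w `^ p * s (Y w)).
Proof.
apply: measurable_funM.
  exact: (measurableT_comp (f := fun y => y `^ p) (measurable_powR p)).
exact: (measurable_comp_pos _ Y0 _ (measurable_weight _ _ _ cd)).
Qed.

(** Majorant for dominated convergence. The summand [1] covers values of [Y] below 1, and it is
    integrable because [s (Y w)] is. *)
Lemma integrable_dominating C p :
  (\int[P]_w ((Y w `^ p * s (Y w))%:E) < +oo)%E ->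
  P.-integrable setT (fun w => (C * (1 + Y w `^ p) * s (Y w))%:E).
Proof.
move=> pfin.
have mS := measurable_comp_pos Y Y0 _ (measurable_weight _ _ _ cd).
have iS : P.-integrable setT (fun w => (s (Y w))%:E).
  apply/integrableP; split; first exact/measurable_EFinP.
  rewrite (eq_integral (fun w => (s (Y w))%:E)).
    exact: (integral_weight_lty X Y s F0 Y0 cd).
  by move=> w _; rewrite gee0_abs// lee_fin ltW.
have iM : P.-integrable setT (fun w => (Y w `^ p * s (Y w))%:E).
  apply/integrableP; split; first exact/measurable_EFinP/measurable_moment.
  rewrite (eq_integral (fun w => (Y w `^ p * s (Y w))%:E))//.
  by move=> w _; rewrite gee0_abs// lee_fin mulr_ge0 ?powR_ge0// ltW.
have := integrableZl measurableT C (integrableD measurableT iS iM).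
apply: eq_integrable => // w _.
by rewrite -EFinD -EFinM; congr EFin; ring.
Qed.

(** The final ratio divides by this moment. A zero integral would force a strictly positive function
    to vanish almost surely. *)
Lemma moment_gt0 p : (0 < \int[P]_w ((Y w `^ p * s (Y w))%:E))%E.
Proof.
rewrite lt_neqAle integral_ge0 ?andbT; last first.
  by move=> w _; rewrite lee_fin mulr_ge0 ?powR_ge0// ltW.
apply/negP => /eqP/esym E0.
have /(ae_eq_integral_abs P measurableT) : measurable_fun setT
    (fun w => (Y w `^ p * s (Y w))%:E).
  exact/measurable_EFinP/measurable_moment.
move=> /iffLR[].
  rewrite -E0; apply: eq_integral => w _.
  by rewrite gee0_abs// lee_fin mulr_ge0 ?powR_ge0// ltW.
move=> N [mN PN sub].
have : P [set: T] = 0%E.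
  apply: (subset_measure0 _ mN _ PN) => // w _; apply: sub => /= /(_ Logic.I)[].
  by apply/eqP; rewrite gt_eqF// mulr_gt0// powR_gt0.
by rewrite probability_setT => /eqP; rewrite onee_eq0.
Qed.

(** Comparing [y] with 1 gives that the power [p] of [y] is at most 1 plus the power [q]. *)
Lemma moment_lty (p q : R) : 0 <= p -> p <= q ->
  (\int[P]_w ((Y w `^ q * s (Y w))%:E) < +oo)%E ->
  (\int[P]_w ((Y w `^ p * s (Y w))%:E) < +oo)%E.
Proof.
move=> p0 pq /(integrable_dominating 1)/integrableP[mD]; apply: le_lt_trans.
apply: ge0_le_integral => //.
- by move=> w _; rewrite lee_fin mulr_ge0 ?powR_ge0// ltW.
- exact/measurable_EFinP/measurable_moment.
- exact: measurableT_comp.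
- move=> w _; rewrite gee0_abs ?lee_fin; last first.
    by rewrite mul1r mulr_ge0 ?addr_ge0 ?powR_ge0// ltW.
  rewrite mul1r ler_wpM2r ?(ltW (sY0 w))//.
  have [Y1|Y1] := leP 1 (Y w).
    by apply: (le_trans (ler_powR Y1 pq)); rewrite lerDr.
  rewrite -[leLHS]addr0 lerD ?powR_ge0// -[leRHS](powRr0 (Y w)).
  by rewrite ger_powR// Y0 ltW.
Qed.

End moments.

(** * Dominated convergence for the truncated mean *)

Section truncated_limit.
Context {R : realType} {d : measure_display} {T : measurableType d}
  {P : probability T R}.
Variables (X Y : {RV P >-> R}) (s : R -> R) (alpha beta C : R) (h : R -> R).
Hypothesis F0 : forall x, 0 < tailP P X x.
Hypothesis Y0 : forall w, 0 < Y w.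
Hypothesis cd : CD P X Y s.
Hypothesis rv : regvar_tail (tailP P X) alpha.
Hypothesis beta_lty : (\int[P]_w ((Y w `^ beta * s (Y w))%:E) < +oo)%E.
Hypothesis hy : h x @[x --> +oo] --> +oo.
Hypothesis C0 : 0 <= C.
Hypothesis dom : \forall x \near +oo, forall y, 0 < y <= h x ->
  tailP P X (x / y) <= C * (1 + y `^ beta) * tailP P X x.

Let sY0 w : 0 < s (Y w). Proof. exact: weight_gt0 cd _ (Y0 w). Qed.

(** Extension by zero replaces a domain that moves with [x] by a family of functions on the whole
    space. *)
Let kern (x : R) : T -> \bar R :=
  (fun w => (tailP P X (x / Y w) * s (Y w) / tailP P X x)%:E)
    \_ [set w | Y w <= h x].

Let truncated_meanE x :
  (truncated_mean X Y s x (h x) = (tailP P X x)%:E * \int[P]_w kern x w)%E.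
Proof.
rewrite /kern -integral_mkcond /truncated_mean -ge0_integralZl_EFin//.
- apply: eq_integral => w _; rewrite -EFinM [in RHS]mulrC divfK//.
  by rewrite gt_eqF.
- exact: measurable_le.
- by move=> w _; rewrite lee_fin !mulr_ge0 ?invr_ge0// ltW.
- apply/measurable_EFinP; apply: measurable_funTS; apply: measurable_funM => //.
  exact: (measurable_comp_pos _ Y0 _ (measurable_kernel _ _ _ cd x)).
- exact: ltW.
Qed.

Let measurable_kern x : measurable_fun [set: T] (kern x).
Proof.
apply/(measurable_restrictT _ (measurable_le Y (h x))).1.
apply/measurable_EFinP; apply: measurable_funTS; apply: measurable_funM => //.
exact: (measurable_comp_pos _ Y0 _ (measurable_kernel _ _ _ cd x)).
Qed.

Let kern_dom x : (forall y, 0 < y <= h x ->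
    tailP P X (x / y) <= C * (1 + y `^ beta) * tailP P X x) ->
  forall w, (`|kern x w| <= (C * (1 + Y w `^ beta) * s (Y w))%:E)%E.
Proof.
move=> H w; rewrite /kern patchE; case: ifPn => [/set_mem Yh|_]; last first.
  by rewrite abse0 lee_fin !mulr_ge0 ?addr_ge0 ?powR_ge0// ltW.
rewrite gee0_abs lee_fin; last by rewrite !mulr_ge0 ?invr_ge0// ltW.
rewrite mulrAC ler_wpM2r ?(ltW (sY0 w))// ler_pdivrMr//.
by apply: H; rewrite Y0.
Qed.

Let integrable_kern x : (forall y, 0 < y <= h x ->
    tailP P X (x / y) <= C * (1 + y `^ beta) * tailP P X x) ->
  P.-integrable setT (kern x).
Proof.
move=> /kern_dom kd.
apply: le_integrable (integrable_dominating X Y s F0 Y0 cd C beta beta_lty) => //.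
move=> w _; apply: (le_trans (kd w)); rewrite gee0_abs//.
by rewrite lee_fin !mulr_ge0 ?addr_ge0 ?powR_ge0// ltW.
Qed.

Lemma truncated_mean_fin : \forall x \near +oo,
  truncated_mean X Y s x (h x) \is a fin_num.
Proof.
apply: filterS dom => x /integrable_kern /(integrable_fin_num measurableT) k.
by rewrite truncated_meanE fin_numM.
Qed.

(** For fixed [w] the truncation is eventually inactive, and regular variation at the factor
    [(Y w)^-1] gives the pointwise limit; [dom] gives the majorant. The limit at infinity is tested
    along sequences. *)
Lemma truncated_mean_cvg : (\int[P]_w ((Y w `^ alpha * s (Y w))%:E) < +oo)%E ->
  fine (truncated_mean X Y s x (h x)) / tailP P X x @[x --> +oo] -->
  fine (\int[P]_w ((Y w `^ alpha * s (Y w))%:E))%E.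
Proof.
move=> alpha_lty; apply/cvg_pinftyP => u uy.
(* Domination holds only eventually; shifting the sequence by [N] makes it hold at every index. *)
have [N _ HN] : \forall n \near \oo, forall y, 0 < y <= h (u n) ->
    tailP P X (u n / y) <= C * (1 + y `^ beta) * tailP P X (u n).
  exact: (uy _ dom).
rewrite -(cvg_shiftn N).
have := @dominated_convergence _ _ _ P setT measurableT
  (fun n => kern (u (n + N)%N)) (fun w => (Y w `^ alpha * s (Y w))%:E)
  (fun w => (C * (1 + Y w `^ beta) * s (Y w))%:E) (fun=> measurable_kern _).
case => //.
- exact/measurable_EFinP/(measurable_moment X Y s Y0 cd).
- apply: aeW => w _.
  have uNy : u (n + N)%N @[n --> \oo] --> +oo by rewrite cvg_shiftn.
  have Yh : \forall n \near \oo, Y w <= h (u (n + N)%N).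
    have hYw : \forall x \near +oo, Y w <= h x by exact: ((cvgryPge h).1 hy).
    exact: (uNy _ hYw).
  apply: (@cvg_trans _ ((tailP P X (u (n + N)%N / Y w) / tailP P X (u (n + N)%N)
      * s (Y w))%:E @[n --> \oo])).
    apply: near_eq_cvg; apply: filterS Yh => n Yn.
    by rewrite /kern patchE mem_set//= mulrAC.
  apply: cvg_EFin; first by apply: nearW.
  apply: cvgMl.
  have YV : 0 < (Y w)^-1 by rewrite invr_gt0.
  have := rv _ YV; rewrite -powR_inv1 ?(ltW (Y0 w))// -powRrM mulN1r opprK => rvY.
  have := (cvg_pinftyP _ _).1 rvY _ uNy.
  by rewrite powR_inv1// ltW.
- exact: (integrable_dominating X Y s F0 Y0 cd).
- apply: aeW => w n _; apply: kern_dom.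
  by apply: HN => /=; rewrite leq_addl.
move=> _ _ dct.
have mfin : (\int[P]_w ((Y w `^ alpha * s (Y w))%:E))%E \is a fin_num.
  rewrite ge0_fin_numE// integral_ge0// => w _.
  by rewrite lee_fin mulr_ge0 ?powR_ge0// ltW.
move: dct; rewrite -{1}(fineK mfin) => /fine_cvg.
apply: cvg_trans; apply: near_eq_cvg; apply: nearW => n /=.
have := integrable_kern _ (HN (n + N)%N (leq_addl _ _)).
move=> /(integrable_fin_num measurableT) k.
by rewrite truncated_meanE fineM//= mulrAC divff ?mul1r// gt_eqF.
Qed.

End truncated_limit.

(* [h] is the truncation level of [Y] at scale [x]: below it the ratio
   [tailP X (x / Y) / tailP X x] is dominated by [1 + Y ^ beta] and
   conditional dependence applies beyond [z0]; above it [Y] is negligible. *)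
Definition cutoff {R : realType} {d : measure_display} {T : measurableType d}
    (P : probability T R) (X Y : T -> R) (s : R -> R) (alpha z0 : R) : Prop :=
  exists (h : R -> R) (beta C : R), [/\ alpha <= beta, 0 <= C,
    (\int[P]_w ((Y w `^ beta * s (Y w))%:E) < +oo)%E,
    h x @[x --> +oo] --> +oo &
    [/\ \forall x \near +oo, z0 < x / h x,
      tailP P Y (h x) / tailP P X x @[x --> +oo] --> (0 : R) &
      \forall x \near +oo, forall y, 0 < y <= h x ->
        tailP P X (x / y) <= C * (1 + y `^ beta) * tailP P X x]].

(** * Asymptotics of the product tail and existence of truncation levels *)

Section asymptotics.
Context {R : realType} {d : measure_display} {T : measurableType d}
  {P : probability T R}.
Variables (X Y : {RV P >-> R}) (s : R -> R) (alpha : R).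
Hypothesis F0 : forall x, 0 < tailP P X x.
Hypothesis Y0 : forall w, 0 < Y w.
Hypothesis cd : CD P X Y s.
Hypothesis a0 : 0 <= alpha.
Hypothesis rv : regvar_tail (tailP P X) alpha.

(** P(XY > x) exceeds P(XY > x, Y <= h x) by at most P(Y > h x). The latter is negligible, and the
    former is within a factor [1 - e] to [1 + e] of the truncated mean. *)
Lemma product_tail_cvg : (forall z0, cutoff P X Y s alpha z0) ->
  tailP P (fun w => X w * Y w) x /
    (fine (\int[P]_w ((Y w `^ alpha * s (Y w))%:E)) * tailP P X x)
    @[x --> +oo] --> (1 : R).
Proof.
move=> cut; set m := fine _.
have m_lty : (\int[P]_w ((Y w `^ alpha * s (Y w))%:E) < +oo)%E.
  have [h [beta [C [ab _ blty _ _]]]] := cut 0.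
  exact: (moment_lty X Y s F0 Y0 cd alpha beta a0 ab blty).
have m0 : 0 < m.
  have mgt0 := moment_gt0 X Y s Y0 cd alpha.
  by rewrite -lte_fin /m fineK// ge0_fin_numE// ltW.
apply/cvgrPdist_le => e' e'0.
(* The errors accumulate to at most [4 * e], and the cap at 1 lets the quadratic terms be
   absorbed. *)
pose e := Num.min e' 1 / 4.
have e0 : 0 < e by rewrite divr_gt0// lt_min e'0/=.
have ele : e <= e' / 4 by rewrite ler_wpM2r// ge_min lexx.
have e4 : e <= 4^-1 by rewrite -[leRHS]mul1r ler_wpM2r// ge_min lexx orbT.
have e01 : 0 < e < 1 by rewrite e0/=; lra.
have [z0 Hz0] := product_tail_bounds X Y s F0 Y0 cd _ a0 rv _ e01.
have [h [beta [C [ab C0 blty hy [hz0 hY dom]]]]] := cut z0.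
have tfin := truncated_mean_fin X Y s beta C h F0 Y0 cd blty C0 dom.
have tcvg := truncated_mean_cvg X Y s alpha beta C h F0 Y0 cd rv blty hy C0 dom m_lty.
have em0 : 0 < e * m by rewrite mulr_gt0.
near=> x.
have x0 : 0 < x by near: x; apply: nbhs_pinfty_gt; exact: num_real.
have hx0 : 0 < h x by near: x; exact: ((cvgryPgt h).1 hy).
have zx : z0 < x / h x by near: x.
have [lo hi] := Hz0 x (h x) x0 hx0 zx.
have tx : truncated_mean X Y s x (h x) \is a fin_num by near: x.
have J1 : fine (truncated_mean X Y s x (h x)) / tailP P X x < m + e * m.
  by near: x; apply: (cvgr_lt m tcvg); rewrite ltrDl.
have J2 : m - e * m < fine (truncated_mean X Y s x (h x)) / tailP P X x.
  by near: x; apply: (cvgr_gt m tcvg); rewrite gtrBl.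
have rx : tailP P Y (h x) / tailP P X x < e * m.
  by near: x; apply: (cvgr_lt 0 hY).
have Fx := F0 x.
pose A := [set w | x < X w * Y w].
have mA : measurable A by exact: measurable_prod_gt.
have mAh : measurable (A `&` [set w | Y w <= h x]).
  by apply: measurableI => //; exact: measurable_le.
have fA := fin_num_measure P _ mA; have fAh := fin_num_measure P _ mAh.
have p1 : fine (P (A `&` [set w | Y w <= h x])) <= fine (P A).
  by apply: fine_le => //; apply: measureIl => //; exact: measurable_le.
have p2 : fine (P A) <= fine (P (A `&` [set w | Y w <= h x])) + tailP P Y (h x).
  rewrite -lee_fin EFinD (fineK fA) (fineK fAh) -tailPE.
  apply: (le_trans _ (measureU2 _ mAh (measurable_gt P Y (h x)))).
  apply: le_measure; rewrite ?inE//.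
    by apply: measurableU => //; exact: measurable_gt.
  move=> w Aw; have [Yh|Yh] := leP (Y w) (h x); [left|right] => //.
move: lo hi; rewrite -[in X in X -> _](fineK tx) -[in X in _ -> X -> _](fineK tx).
rewrite -[in X in X -> _](fineK fAh) -[in X in _ -> X -> _](fineK fAh).
rewrite -!EFinM !lee_fin => lo hi.
move: J1 J2 rx lo hi p1 p2.
rewrite ltr_pdivrMr// ltr_pdivlMr// ltr_pdivrMr//.
set J := fine (truncated_mean _ _ _ _ _); set q := fine (P (A `&` _)).
rewrite -/(tailP P (fun w => X w * Y w) x).
set p := tailP _ (fun w => X w * Y w) x; set F := tailP P X x; set G := tailP _ _ (h x).
move=> J1 J2 rx lo hi p1 p2.
have mF0 : 0 < m * F by rewrite mulr_gt0.
(* The lower factor is the square of [1 - e]; the upper one is the square of [1 + e] plus an [e] for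
   the event Y > h x. *)
have lower : (1 - 3 * e) * (m * F) <= p.
  nra.
have upper : p <= (1 + 4 * e) * (m * F).
  nra.
rewrite distrC ler_norml lerBrDr ler_pdivlMr// lerBlDr ler_pdivrMr//.
apply/andP; split.
  by apply: le_trans lower; rewrite ler_pM2r//; lra.
by apply: (le_trans upper); rewrite ler_pM2r//; lra.
Unshelve. all: by end_near. Qed.

(** With [h x = x / x1] the tails of [X] at [h x] and at [x] are comparable, so the tail of [Y] at
    [h x] is negligible. For 1 <= y <= h x the level [x / y] is at least [x1], within the range of
    Potter's bound. *)
Lemma cutoff_potter (eps : R) : 0 < eps ->
  (\int[P]_w ((Y w `^ (alpha + eps) * s (Y w))%:E) < +oo)%E ->
  tailP P Y x / tailP P X x @[x --> +oo] --> (0 : R) ->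
  forall z0, cutoff P X Y s alpha z0.
Proof.
move=> eps0 Elty YX z0.
have [C [z1 pot]] := potter_bound _ _ _ a0 eps0 F0 (tailP_nonincreasing P X) rv.
(* [x / h x] equals [x1], which must exceed the prescribed [z0], the Potter threshold [z1] and 0. *)
pose x1 := Num.max (Num.max z0 z1) 0 + 1.
have x10 : 0 < x1 by rewrite ltr_wpDl// le_max lexx orbT.
have x1z0 : z0 < x1.
  by apply: (@le_lt_trans _ _ (Num.max (Num.max z0 z1) 0)); rewrite ?ltrDl// !le_max lexx.
have x1z1 : z1 < x1.
  by apply: (@le_lt_trans _ _ (Num.max (Num.max z0 z1) 0)); rewrite ?ltrDl// !le_max lexx orbT.
have x1V : 0 < x1^-1 by rewrite invr_gt0.
have hy : x / x1 @[x --> +oo] --> +oo.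
  apply/cvgryPge => M; apply: filterS (nbhs_pinfty_ge (num_real (M * x1))) => x.
  by rewrite ler_pdivlMr.
(* The constant [|C| + 1] is at least [C], and at least 1 as the case [y < 1] requires. *)
exists (fun x => x / x1), (alpha + eps), (`|C| + 1); split => //.
  by rewrite lerDl ltW.
split.
- near=> x; have x0 : 0 < x by near: x; apply: nbhs_pinfty_gt; exact: num_real.
  by rewrite invf_div mulrCA divff ?mulr1// gt_eqF.
- have h1 : tailP P Y (x / x1) / tailP P X (x / x1) @[x --> +oo] --> (0 : R).
    exact: (cvg_comp (fun x => x / x1) (fun x => tailP P Y x / tailP P X x) hy YX).
  have h2 := cvgM h1 (rv _ x1V); rewrite mul0r in h2; apply: (cvg_trans _ (h2 _)).
  apply: near_eq_cvg; apply: nearW => x /=.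
  by rewrite -mulrA mulKf// gt_eqF.
- near=> x; have x0 : 0 < x by near: x; apply: nbhs_pinfty_gt; exact: num_real.
  move=> y /andP[y0 yx].
  have [y1|y1] := leP 1 y.
    apply: (le_trans (pot x y x0 y1 _)).
      by apply: (lt_le_trans x1z1); rewrite ler_pdivlMr// mulrC -ler_pdivlMr.
    rewrite ler_wpM2r ?(ltW (F0 x))//.
    apply: (@le_trans _ _ ((`|C| + 1) * y `^ (alpha + eps))).
      by rewrite ler_wpM2r ?powR_ge0// (le_trans (ler_norm _))// lerDl.
    by rewrite ler_wpM2l ?addr_ge0// lerDr.
  apply: (@le_trans _ _ (tailP P X x)).
    by apply: tailP_nonincreasing; rewrite ler_pdivlMr// ger_pMr// ltW.
  rewrite ler_peMl ?(ltW (F0 x))// -[leLHS]mulr1 ler_pM// ?lerDr//.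
  by rewrite lerDl powR_ge0.
Unshelve. all: by end_near. Qed.

(** With [h x = x * g x] the quotient [x / h x] is the inverse of [g x] and tends to infinity.
    Domination with [beta = alpha] follows by replacing the tail of [X], at [x] and at [x / y], by
    its regularly varying form and bounding the quotient of the values of [L]. *)
Lemma cutoff_slowly_varying (L g : R -> R) :
  (forall x : R, 0 < x -> 0 < L x) ->
  tailP P X x / (x `^ (- alpha) * L x) @[x --> +oo] --> (1 : R) ->
  (forall x, 0 <= x -> 0 < g x) ->
  g x @[x --> +oo] --> (0 : R) ->
  x * g x @[x --> +oo] --> +oo ->
  tailP P Y (x * g x) / tailP P X x @[x --> +oo] --> (0 : R) ->
  (exists M : R, exists x0 : R, forall x, x0 < x ->
     forall y, 1 <= y <= x * g x -> L (x / y) / L x <= M) ->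
  (\int[P]_w ((Y w `^ alpha * s (Y w))%:E) < +oo)%E ->
  forall z0, cutoff P X Y s alpha z0.
Proof.
move=> L0 FL g0 gcvg xgy YX [M [x0 HM]] mlty z0.
have [z1 Hz1] : exists z1 : R, forall z, z1 < z ->
    2^-1 < tailP P X z / (z `^ (- alpha) * L z) < 2.
  apply: near_pinftyP; near=> z; apply/andP; split; near: z.
  - by apply: (cvgr_gt 1 FL); lra.
  - by apply: (cvgr_lt 1 FL); lra.
(* The 4 is the quotient of the bounds 2 and 1/2 of [Hz1]; [|M| + 1] is at least [M] and makes [C]
   at least 1 for the case [y < 1]. *)
pose C := 4 * (`|M| + 1).
have C0 : 0 <= C by rewrite mulr_ge0// addr_ge0.
exists (fun x => x * g x), alpha, C; split => //.
(* Used for [z0], and for [z1] to bring every [x / y] with y <= h x into the range of [Hz1]. *)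
have near_large (z : R) : \forall x \near +oo, z < x / (x * g x).
  have z'0 : 0 < (`|z| + 1)^-1 by rewrite invr_gt0 ltr_wpDl.
  near=> x; have xp : 0 < x by near: x; apply: nbhs_pinfty_gt; exact: num_real.
  have gx0 := g0 x (ltW xp).
  have gx : g x < (`|z| + 1)^-1 by near: x; exact: (cvgr_lt 0 gcvg).
  rewrite invfM mulrA divff ?mul1r ?gt_eqF//.
  apply: (@lt_trans _ _ (`|z| + 1)); first by rewrite (le_lt_trans (ler_norm _))// ltrDl.
  by rewrite -[ltLHS]invrK ltf_pV2.
split => //.
near=> x; have xp : 0 < x by near: x; apply: nbhs_pinfty_gt; exact: num_real.
have gx0 := g0 x (ltW xp).
have xz1 : z1 < x by near: x; apply: nbhs_pinfty_gt; exact: num_real.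
have xx0 : x0 < x by near: x; apply: nbhs_pinfty_gt; exact: num_real.
have xg1 : z1 < x / (x * g x) by near: x; exact: near_large.
have Fx := F0 x.
move=> y /andP[y0 yx].
have [y1|y1] := leP 1 y; last first.
  apply: (@le_trans _ _ (tailP P X x)).
    by apply: tailP_nonincreasing; rewrite ler_pdivlMr// ger_pMr// ltW.
  rewrite ler_peMl ?(ltW (F0 x))// -[leLHS]mulr1 ler_pM//.
    by rewrite /C; have := normr_ge0 M; lra.
  by rewrite lerDl powR_ge0.
have LM := HM x xx0 y (introT andP (conj y1 yx)).
have xy0 : 0 < x / y by rewrite divr_gt0.
have xyz1 : z1 < x / y.
  by apply: (lt_le_trans xg1); rewrite ler_pM2l// lef_pV2 ?posrE// mulr_gt0.
have Lx0 := L0 _ xp; have Lxy0 := L0 _ xy0.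
have [_] := andP (Hz1 _ xyz1); rewrite ltr_pdivrMr ?mulr_gt0 ?powR_gt0// => /ltW up.
have [+ _] := andP (Hz1 _ xz1); rewrite ltr_pdivlMr ?mulr_gt0 ?powR_gt0// => /ltW low.
have xa : (x / y) `^ (- alpha) = x `^ (- alpha) * y `^ alpha.
  rewrite powRM ?(ltW xp) ?invr_ge0 ?(ltW y0)//.
  by rewrite -(powR_inv1 (ltW y0)) -powRrM mulN1r opprK.
apply: (le_trans up); rewrite xa.
have LM' : L (x / y) <= (`|M| + 1) * L x.
  rewrite -ler_pdivrMr//; apply: (le_trans LM).
  by rewrite (le_trans (ler_norm _))// lerDl.
set a := x `^ (- alpha) in low *; set b := y `^ alpha.
have a_gt0 : 0 < a by exact: powR_gt0.
have b_gt0 : 0 < b by exact: powR_gt0.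
apply: (@le_trans _ _ (2 * (a * b * ((`|M| + 1) * L x)))).
  by rewrite ler_pM2l// ler_pM2l// mulr_gt0.
rewrite (_ : 2 * _ = 4 * (`|M| + 1) * b * (2^-1 * (a * L x))); last by field.
apply: ler_pM => //.
- by rewrite !mulr_ge0 ?addr_ge0// ltW.
- by rewrite !mulr_ge0 ?invr_ge0// ltW.
- by rewrite /C ler_wpM2l// lerDr.
Unshelve. all: by end_near. Qed.

End asymptotics.

Theorem theorem2p1 (R : realType) (d : measure_display) (T : measurableType d)
  (P : probability T R) (X Y : {RV P >-> R}) (s : R -> R) (alpha : R)
  (L : R -> R) :
  (forall x : R, 0 < tailP P X x) ->
  (forall w, 0 < Y w) ->
  CD P X Y s ->
  0 <= alpha ->
  regvar_tail (tailP P X) alpha ->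
  (forall x : R, 0 < x -> 0 < L x) ->
  slowly_varying L ->
  tailP P X x / (x `^ (- alpha) * L x) @[x --> +oo] --> (1 : R) ->
  tailP P Y x / tailP P X x @[x --> +oo] --> (0 : R) ->
  ((exists eps : R, 0 < eps /\
      (\int[P]_w ((Y w `^ (alpha + eps) * s (Y w))%:E) < +oo)%E)
   \/
   (exists g : R -> R,
      (forall x, 0 <= x -> 0 < g x) /\
      {in `[0, +oo[ &, {homo g : a b /~ a <= b}} /\
      g x @[x --> +oo] --> (0 : R) /\
      {in `[0, +oo[ &, {homo (fun x => x * g x) : a b / a <= b}} /\
      x * g x @[x --> +oo] --> +oo /\
      tailP P Y (x * g x) / tailP P X x @[x --> +oo] --> (0 : R) /\
      (exists M : R, exists x0 : R, forall x, x0 < x ->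
         forall y, 1 <= y <= x * g x -> L (x / y) / L x <= M) /\
      (\int[P]_w ((Y w `^ alpha * s (Y w))%:E) < +oo)%E)) ->
  tailP P (fun w => X w * Y w) x /
    (fine (\int[P]_w ((Y w `^ alpha * s (Y w))%:E)) * tailP P X x)
    @[x --> +oo] --> (1 : R).
Proof.
move=> F0 Y0 cd a0 rv L0 _ FL YX [[eps [eps0 Elty]]|].
  apply: (product_tail_cvg X Y s alpha F0 Y0 cd a0 rv).
  exact: (cutoff_potter X Y s alpha F0 a0 rv eps eps0 Elty YX).
move=> [g [g0 [_ [gcvg [_ [xgy [YXg [HM mlty]]]]]]]].
apply: (product_tail_cvg X Y s alpha F0 Y0 cd a0 rv).
exact: (cutoff_slowly_varying X Y s alpha F0 L g L0 FL g0 gcvg xgy YXg HM mlty).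
Qed.
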